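(* Let $X$ be a Dedekind complete Banach lattice on which there exists a special modular. If $\{f_n\}$ is a norm bounded sequence in $X_+$ which uo-converges to $0$, then there is a subsequence $\{f_{n_k}\}$ of $\{f_n\}$ with a splitting $$f_{n_k}=y_k+z_k,$$ where $y_k,z_k\ge0$, $\{y_k\}$ is a disjoint sequence and $\{z_k\}$ is order bounded. In particular, $X$ has the order subsequence splitting property ($OSSP$).
   Context: All Banach lattices are real. Let $X$ be a Banach lattice. A net $\{f_\alpha\}$ in $X$ order converges to $f$ ($f_\alpha\xrightarrow{o}f$) if there is a net $\{h_\gamma\}$ in $X$ (possibly with another index set) with $h_\gamma\downarrow0$ such that for every $\gamma$ there is $\alpha_0$ with $|f_\alpha-f|\le h_\gamma$ for all $\alpha\ge\alpha_0$. It uo-converges to $f$ ($f_\alpha\xrightarrow{uo}f$) if $|f_\alpha-f|\wedge h\xrightarrow{o}0$ for every $h\in X_+$. A functional $\rho:X\to[0,\infty]$ is a special modular on $X$ if: (M1) if $f\in X_+$ and $\rho(f)<\infty$, then $\rho(f_n)\to0$ whenever $\{f_n\}$ is a sequence with $f_n\xrightarrow{o}0$ and $0\le f_n\le f$; (M2) if $\{f_n\}$ is a sequence in $X$ with $\sum_n\rho(f_n)<\infty$, then a subsequence of $\{f_n\}$ is order bounded; (M3) $\rho(f)<\infty$ for every $f$ in the closed unit ball of $X$. The order continuous part $X_a$ is the set of all $f\in X$ such that $\|f_\alpha\|\to0$ whenever $f_\alpha\xrightarrow{o}0$ and $|f_\alpha|\le|f|$. $OSSP$: every norm bounded sequence $\{f_n\}$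 in $X_+$ with $f_n\xrightarrow{uo}0$ has a subsequence with $f_{n_k}=x_k+y_k+z_k$, where $x_k,y_k,z_k\ge0$, $x_k\in X_a$ for all $k$, $\{y_k\}$ is a disjoint sequence, and $\{z_k\}$ is order bounded. *)

(* Defs.v *)
From HB Require Import structures.
From mathcomp Require Import all_boot all_order all_algebra.
From mathcomp Require Import all_classical all_reals all_analysis.
Import Order.TTheory GRing.Theory Num.Theory.
Import numFieldNormedType.Exports.

Set Implicit Arguments.
Unset Strict Implicit.
Unset Printing Implicit Defensive.

Local Open Scope classical_set_scope.
Local Open Scope ring_scope.

(* The order is a field of the mixin, and MathComp's lattice structure is
   derived from it below, because Hierarchy-Builder rejects a structure
   inheriting from both Order.Lattice and CompleteNormedModule that is declared
   after Num.NumDomain. The lattice absolute value is written out as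
   x \/ -x; [`|x|] is the norm. *)
HB.mixin Record isBanachLattice (R : realType) X
    & CompleteNormedModule R X := {
  bl_le : rel X ;
  bl_meet : X -> X -> X ;
  bl_join : X -> X -> X ;
  bl_lexx : reflexive bl_le ;
  bl_le_anti : antisymmetric bl_le ;
  bl_le_trans : transitive bl_le ;
  bl_lexI : forall x y z : X, bl_le x (bl_meet y z) = bl_le x y && bl_le x z ;
  bl_leUx : forall x y z : X, bl_le (bl_join x y) z = bl_le x z && bl_le y z ;
  bl_leD2r : forall z x y : X, bl_le x y -> bl_le (x + z) (y + z) ;
  bl_leZ : forall (a : R) (x y : X), 0 <= a -> bl_le x y ->
    bl_le (a *: x) (a *: y) ;
  bl_le_norm : forall x y : X,
    bl_le (bl_join x (- x)) (bl_join y (- y)) -> `|x| <= `|y|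
}.

#[short(type="banachLatticeType")]
HB.structure Definition BanachLattice (R : realType) :=
  { X of CompleteNormedModule R X & isBanachLattice R X }.

Section lattice_instance.
Variables (R : realType) (X : banachLatticeType R).

HB.instance Definition _ := Order.Le_isPOrder.Build ring_display X
  (@bl_lexx R X) (@bl_le_anti R X) (@bl_le_trans R X).
HB.instance Definition _ := Order.POrder_isMeetSemilattice.Build ring_display X
  (@bl_lexI R X).
HB.instance Definition _ := Order.POrder_isJoinSemilattice.Build ring_display X
  (@bl_leUx R X).

End lattice_instance.

Record directedSet := DirectedSet {
  dir_sort :> Type ;
  dir_le : dir_sort -> dir_sort -> Prop ;
  dir_inhabited : inhabited dir_sort ;
  dir_le_refl : forall i, dir_le i i ;
  dir_le_trans : forall j i k, dir_le i j -> dir_le j k -> dir_le i k ;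
  dir_le_directed : forall i j, exists2 k, dir_le i k & dir_le j k
}.

Lemma nat_directed (m n : nat) : exists2 k, (m <= k)%N & (n <= k)%N.
Proof. by exists (maxn m n); rewrite ?leq_maxl ?leq_maxr. Qed.

(* Canonical, so that a sequence [nat -> X] is read as a net. *)
Canonical nat_directedSet : directedSet :=
  @DirectedSet nat (fun m n => is_true (m <= n)%N)
    (inhabits 0%N) leqnn leq_trans nat_directed.

Definition net_filter (I : directedSet) : set_system I :=
  filter_from setT (fun i => [set j | dir_le i j]).
Arguments net_filter I : clear implicits.

Section banach_lattice_notions.
Variables (R : realType) (X : banachLatticeType R).

Definition labs (x : X) : X := (x `|` - x)%O.

Definition decreases_to (J : directedSet) (h : J -> X) (l : X) : Prop :=
  (forall i j, dir_le i j -> h j <= h i) /\ infimums (range h) l.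

Definition order_cvg (I : directedSet) (f : I -> X) (l : X) : Prop :=
  exists (J : directedSet) (h : J -> X), decreases_to h 0 /\
    forall j, \forall i \near net_filter I, labs (f i - l) <= h j.

Definition uo_cvg (I : directedSet) (f : I -> X) (l : X) : Prop :=
  forall h : X, 0 <= h -> order_cvg (fun i => (labs (f i - l) `&` h)%O) 0.

Definition dedekind_complete : Prop :=
  forall A : set X, A !=set0 -> has_ubound A -> supremums A !=set0.

Definition order_bounded_seq (f : nat -> X) : Prop :=
  exists a b : X, forall n, a <= f n /\ f n <= b.

Definition norm_bounded_seq (f : nat -> X) : Prop :=
  exists M : R, forall n, `|f n| <= M.

Definition disjoint_seq (f : nat -> X) : Prop :=
  forall m n, m <> n -> (labs (f m) `&` labs (f n))%O = 0.

Definition subsequence_index (phi : nat -> nat) : Prop :=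
  forall m n, (m < n)%N -> (phi m < phi n)%N.

Record special_modular (rho : X -> \bar R) : Prop := {
  special_modular_ge0 : forall f, (0 <= rho f)%E ;
  special_modular_M1 : forall f : X, 0 <= f -> (rho f < +oo)%E ->
    forall u : nat -> X, order_cvg u 0 -> (forall n, 0 <= u n /\ u n <= f) ->
    rho (u n) @[n --> \oo] --> 0%E ;
  special_modular_M2 : forall f : nat -> X,
    (\sum_(0 <= n <oo) rho (f n) < +oo)%E ->
    exists phi, subsequence_index phi /\ order_bounded_seq (f \o phi) ;
  special_modular_M3 : forall f, `|f| <= 1 -> (rho f < +oo)%E
}.

Definition order_continuous_part : set X :=
  [set f | forall (I : directedSet) (u : I -> X), order_cvg u 0 ->
     (forall i, labs (u i) <= labs f) -> `|u i| @[i --> net_filter I] --> 0].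

End banach_lattice_notions.

Definition OSSP (R : realType) (X : banachLatticeType R) : Prop :=
  forall f : nat -> X, norm_bounded_seq f -> (forall n, 0 <= f n) ->
  uo_cvg f 0 ->
  exists phi, subsequence_index phi /\
  exists x y z : nat -> X,
    [/\ forall k, f (phi k) = x k + y k + z k,
        forall k, [/\ 0 <= x k, 0 <= y k & 0 <= z k],
        forall k, order_continuous_part (x k),
        disjoint_seq y & order_bounded_seq z].

(* Main.v *)
(** The disjoint part of a nonnegative sequence [g] can be taken to be
    [y_k = inf_(l <> k) (g_k - g_l)^+ = g_k - sup_(l <> k) (g_l /\ g_k)], so it
    is enough to find a subsequence whose pairwise meets have a common upper
    bound. After scaling into the unit ball, the tail suprema
    [t_(i,m) = sup_(n >= m) (f_n /\ f_i)] are dominated by [f_i] and order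
    converge to 0 as [m] grows. By (M3) and (M1) one can pick [m_i] such that
    [rho (t_(i,m_i)) <= 2^-(i+1)]; by (M2) infinitely many of the [t_(i,m_i)] lie
    below a single [b], and thinning these indices so that each one exceeds the
    [m_i] of its predecessor gives [f_i /\ f_j <= b] for any two of them. *)
Require Import Defs.
From mathcomp Require Import all_boot all_order all_algebra.
From mathcomp Require Import all_classical all_reals all_analysis.
Import Order.TTheory GRing.Theory Num.Theory.
Local Open Scope classical_set_scope.
Local Open Scope ring_scope.

Lemma bl_leD2rE {R : realType} {X : banachLatticeType R} (z x y : X) :
  (x + z <= y + z) = (x <= y).
Proof.
apply/idP/idP => [le_xy|]; last exact: (bl_leD2r z).
by rewrite -(addrK z x) -(addrK z y); exact: (bl_leD2r (- z)).
Qed.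

Lemma bl_subr_ge0 {R : realType} {X : banachLatticeType R} (x y : X) :
  (0 <= y - x) = (x <= y).
Proof. by rewrite -(@bl_leD2rE _ _ x 0) add0r subrK. Qed.

Lemma bl_leBlDr {R : realType} {X : banachLatticeType R} (x y z : X) :
  (x - y <= z) = (x <= z + y).
Proof. by rewrite -(@bl_leD2rE _ _ y (x - y)) subrK. Qed.

Lemma bl_scaler_ge0 {R : realType} {X : banachLatticeType R} (a : R) (x : X) :
  0 <= a -> 0 <= x -> 0 <= a *: x.
Proof. by move=> a0 x0; rewrite -(scaler0 X a); exact: bl_leZ. Qed.

Lemma bl_scaler_le {R : realType} {X : banachLatticeType R} (a : R) (x : X) :
  a <= 1 -> 0 <= x -> a *: x <= x.
Proof.
move=> a1 x0; rewrite -bl_subr_ge0 -{1}[x]scale1r -scalerBl.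
by apply: bl_scaler_ge0; rewrite // subr_ge0.
Qed.

Lemma bl_oppr_le0 {R : realType} {X : banachLatticeType R} (x : X) :
  (- x <= 0) = (0 <= x).
Proof. by rewrite -(@bl_leD2rE _ _ x (- x)) add0r addNr. Qed.

Lemma labs_pos {R : realType} {X : banachLatticeType R} (x : X) :
  0 <= x -> labs x = x.
Proof.
move=> x0; rewrite /labs; apply/join_idPl; apply: (le_trans _ x0).
by rewrite bl_oppr_le0.
Qed.

Lemma labs_eq0 {R : realType} {X : banachLatticeType R} (x : X) :
  labs x <= 0 -> x = 0.
Proof. by rewrite leUx bl_oppr_le0 => /le_anti. Qed.

(** Adding the meet of [x] and [y] to a lower bound of both differences gives a lower bound of [x]
    and [y], so the lower bound was at most 0. *)
Lemma meetB_disjoint {R : realType} {X : banachLatticeType R} (x y : X) :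
  ((x - x `&` y) `&` (y - x `&` y))%O = 0.
Proof.
apply/eqP; rewrite eq_le lexI !bl_subr_ge0 leIl leIr !andbT.
rewrite -(@bl_leD2rE _ _ (x `&` y)%O (_ `&` _)%O) add0r lexI.
by rewrite -[in X in X && _](bl_leD2rE (- (x `&` y)%O)) addrK leIl
           -(bl_leD2rE (- (x `&` y)%O)) addrK leIr.
Qed.

(** The net [h] that dominates [u] also dominates [s]: a bound [h j] valid from index [m] on bounds
    every supremum over a tail starting at or after [m]. *)
Lemma order_cvg_tail_sup {R : realType} {X : banachLatticeType R}
    (u s : nat -> X) :
  (forall n, 0 <= u n) -> order_cvg u 0 ->
  (forall m, supremums [set u n | n in [set n | (m <= n)%N]] (s m)) ->
  order_cvg s 0.
Proof.
move=> u0 [J [h [hdec uh]]] hs; exists J, h; split=> // j.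
have [m _ hm] := uh j; exists m => // n /= le_mn; rewrite subr0 labs_pos.
  apply: (hs n).2 => _ [k /= le_nk <-].
  by have := hm k (leq_trans le_mn le_nk); rewrite /= subr0 labs_pos.
by apply: le_trans (u0 n) ((hs n).1 _ _); exists n => /=.
Qed.

Lemma disjoint_splitting {R : realType} {X : banachLatticeType R}
    (Xdc : dedekind_complete X) (g : nat -> X) (b : X) :
  (forall k, 0 <= g k) ->
  (forall k l, k <> l -> (g k `&` g l)%O <= b) ->
  exists y z : nat -> X,
    [/\ forall k, g k = y k + z k,
        forall k, 0 <= y k /\ 0 <= z k,
        disjoint_seq y & order_bounded_seq z].
Proof.
move=> g0 gb.
pose A k := [set (g k `&` g l)%O | l in [set l | k <> l]].
(* The successor index witnesses that [A k] is nonempty, and later that its supremum is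
   nonnegative. *)
have neqS k : k <> k.+1 by move=> /eqP; rewrite ltn_eqF.
have /choice[z zP] k : exists z, supremums (A k) z.
  have [||x Ax] := Xdc (A k); last by exists x.
    by exists (g k `&` g k.+1)%O, k.+1 => /=.
  by exists (g k) => _ [l _ <-]; exact: leIl.
have z_ge k l : k <> l -> (g k `&` g l)%O <= z k.
  by move=> kl; apply: (zP k).1; exists l.
have z0 k : 0 <= z k.
  by apply: le_trans (z_ge k _ (neqS k)); rewrite lexI !g0.
have zg k : z k <= g k by apply: (zP k).2 => _ [l _ <-]; exact: leIl.
have y0 k : 0 <= g k - z k by rewrite bl_subr_ge0.
have yB k l : k <> l -> g k - z k <= g k - (g k `&` g l)%O.
  move=> /z_ge le_z; rewrite bl_leBlDr addrAC -bl_leBlDr opprK.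
  by rewrite addrC -(bl_leD2rE (- g k)) addrAC subrr add0r addrK.
exists (fun k => g k - z k), z; split=> [k|k|k l kl|].
- by rewrite subrK.
- by [].
- rewrite !labs_pos //; apply/eqP; rewrite eq_le lexI !y0 !andbT.
  (* Both terms are enlarged by subtracting only the one meet of [g k] and [g l]; the enlarged terms
     are already disjoint. *)
  rewrite -(meetB_disjoint (g k) (g l)).
  by apply: leI2; [exact: yB | rewrite meetC; apply: yB; exact: nesym].
- exists 0, b => k; split=> //.
  by apply: (zP k).2 => _ [l kl <-]; exact: gb.
Qed.

Lemma bounded_meet_subsequence {R : realType} {X : banachLatticeType R}
    (Xdc : dedekind_complete X) (rho : X -> \bar R) (rhoM : special_modular rho)
    (f : nat -> X) :
  (forall n, `|f n| <= 1) -> (forall n, 0 <= f n) -> uo_cvg f 0 ->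
  exists phi, subsequence_index phi /\
  exists b, forall k l, k <> l -> (f (phi k) `&` f (phi l))%O <= b.
Proof.
move=> f1 f0 fuo.
pose T i m := [set (f n `&` f i)%O | n in [set n | (m <= n)%N]].
have /choice[t tP] (im : nat * nat) : exists t, supremums (T im.1 im.2) t.
  case: im => i m; have [||x Tx] := Xdc (T i m); last by exists x.
    by exists (f m `&` f i)%O, m => /=.
  by exists (f i) => _ [n _ <-]; exact: leIr.
have t0 i m : 0 <= t (i, m).
  apply: (@le_trans _ _ (f m `&` f i)%O); first by rewrite lexI !f0.
  by apply: (tP (i, m)).1; exists m => /=.
have tf i m : t (i, m) <= f i.
  by apply: (tP (i, m)).2 => _ [n _ <-]; exact: leIr.
have t_cvg i : order_cvg (fun m => t (i, m)) 0.
  apply: (@order_cvg_tail_sup _ _ (fun n => (f n `&` f i)%O)).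
  - by move=> n; rewrite lexI !f0.
  (* Unbounded order convergence is tested against [f i] itself. *)
  - have := fuo (f i) (f0 i); congr (order_cvg _ _).
    by apply/funext => n; rewrite subr0 labs_pos.
  - by move=> m; exact: (tP (i, m)).
have /choice[m mP] i :
    exists m, (rho (t (i, m)) <= (1 / (2 ^ i.+1)%:R)%:E)%E.
  have tto0 := special_modular_M1 rhoM (f0 i)
    (special_modular_M3 rhoM (f1 i)) (t_cvg i)
    (fun m => conj (t0 i m) (tf i m)).
  have e0 : (0 < (1 / (2 ^ i.+1)%:R)%:E :> \bar R)%E.
    by rewrite lte_fin divr_gt0 // ltr0n expn_gt0.
  have [N _ NP] := tto0 _ (open_ereal_lt' e0).
  by exists N; apply/ltW/NP => /=.
have : (\sum_(0 <= i <oo) rho (t (i, m i)) < +oo)%E.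
  apply: le_lt_trans (ltry (1 : R)).
  (* The bounds [1 / 2 ^ i.+1] sum to at most 1. *)
  apply: le_trans (epsilon_trick0 xpredT ler01).
  apply: lee_nneseries => [i _ _|i _]; last exact: mP.
  exact: special_modular_ge0.
move=> /(special_modular_M2 rhoM)[phi [phi_incr [a [b tb]]]].
(* [psi] selects positions within [phi]: [p.+1] forces strict growth, and [m (phi p)] pushes the
   next position past the threshold of the current index. *)
pose psi k := iter k (fun p => maxn p.+1 (m (phi p))) 0%N.
have psiS k : psi k.+1 = maxn (psi k).+1 (m (phi (psi k))) by [].
have psi_incr : subsequence_index psi.
  apply: (homo_ltn ltn_trans) => k.
  by rewrite psiS leq_maxl.
have phi_ge p : (p <= phi p)%N.
  by elim: p => // p IH; exact: leq_ltn_trans IH (phi_incr _ _ (ltnSn p)).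
exists (phi \o psi); split=> [k l kl|]; first exact/phi_incr/psi_incr.
have meet_le k l : (k < l)%N -> (f (phi (psi l)) `&` f (phi (psi k)))%O <= b.
  (* Since [phi (psi l) >= psi l >= psi k.+1 >= m (phi (psi k))], this meet belongs to the tail
     whose supremum is bounded by [b]. *)
  move=> kl; apply: le_trans (tb (psi k)).2; apply: (tP (_, _)).1.
  exists (phi (psi l)) => //=.
  apply: leq_trans (phi_ge _); apply: (@leq_trans (psi k.+1)).
    by rewrite psiS leq_maxr.
  by move: kl; rewrite leq_eqVlt => /predU1P[<-//|/psi_incr/ltnW].
exists b => k l /eqP; rewrite neq_ltn => /orP[] kl /=; last exact: meet_le.
by rewrite meetC; exact: meet_le.
Qed.

Lemma disjoint_bounded_splitting {R : realType} {X : banachLatticeType R}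
    (Xdc : dedekind_complete X) (rho : X -> \bar R) (rhoM : special_modular rho)
    (f : nat -> X) :
  norm_bounded_seq f -> (forall n, 0 <= f n) -> uo_cvg f 0 ->
  exists phi, subsequence_index phi /\
  exists y z : nat -> X,
    [/\ forall k, f (phi k) = y k + z k,
        forall k, 0 <= y k /\ 0 <= z k,
        disjoint_seq y & order_bounded_seq z].
Proof.
move=> [M fM] f0 fuo.
(* Dividing by [c >= M] lands in the unit ball, while [c >= 1] keeps the scaled sequence below [f],
   so that it inherits uo-convergence with the same dominating nets. *)
pose c := Num.max 1 M.
have c1 : 1 <= c by rewrite le_max lexx.
have c0 : 0 < c := lt_le_trans ltr01 c1.
have ci0 : 0 <= c^-1 by rewrite invr_ge0 ltW.
have [|||phi [phi_incr [b gb]]] :=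
    @bounded_meet_subsequence _ _ Xdc _ rhoM (fun n => c^-1 *: f n).
- move=> n; rewrite normrZ ger0_norm // mulrC ler_pdivrMr //.
  by rewrite mul1r (le_trans (fM n)) // le_max lexx orbT.
- by move=> n; rewrite bl_scaler_ge0.
- move=> h h0; have [J [v [vdec fv]]] := fuo h h0; exists J, v; split=> // j.
  have [n0 _ n0P] := fv j; exists n0 => // n /n0P /=; rewrite !subr0.
  have cf0 : 0 <= c^-1 *: f n by rewrite bl_scaler_ge0.
  rewrite (labs_pos _ (f0 n)) (labs_pos _ cf0) !labs_pos ?lexI ?f0 ?cf0 //.
  by apply: le_trans; apply: leI2 => //; rewrite bl_scaler_le // invf_le1.
exists phi; split=> //; apply: (@disjoint_splitting _ _ Xdc _ (c *: b)) => // k l.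
(* The meet divided by [c] is a lower bound of the two scaled terms, hence lies below their meet and
   below [b]. *)
move=> /gb fkl; rewrite -[(_ `&` _)%O]scale1r -(mulfV (lt0r_neq0 c0)) -scalerA.
apply: bl_leZ; first exact: ltW.
apply: le_trans fkl; rewrite lexI.
by apply/andP; split; apply: bl_leZ => //; [exact: leIl | exact: leIr].
Qed.

Lemma order_continuous_part0 {R : realType} {X : banachLatticeType R} :
  order_continuous_part (0 : X).
Proof.
move=> I u _ u0; have -> : u = fun=> 0.
  by apply/funext => i; apply: labs_eq0; rewrite -[leRHS](labs_pos _ (lexx 0)).
(* The net is constantly 0, so any index witnesses convergence. *)
by rewrite normr0 => A /nbhs_singleton A0; have [i] := dir_inhabited I; exists i.
Qed.

Theorem proposition3p2 (R : realType) (X : banachLatticeType R)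
    (Xdc : dedekind_complete X)
    (Xsm : exists rho : X -> \bar R, special_modular rho) :
  (forall f : nat -> X, norm_bounded_seq f -> (forall n, 0 <= f n) ->
   uo_cvg f 0 ->
   exists phi, subsequence_index phi /\
   exists y z : nat -> X,
     [/\ forall k, f (phi k) = y k + z k,
         forall k, 0 <= y k /\ 0 <= z k,
         disjoint_seq y & order_bounded_seq z])
  /\ OSSP X.
Proof.
have [rho rhoM] := Xsm.
split; first exact: (disjoint_bounded_splitting Xdc _ rhoM).
move=> f fM f0 fuo.
have [phi [phi_incr [y [z [fE yz0 ydis zbd]]]]] :=
  disjoint_bounded_splitting Xdc _ rhoM _ fM f0 fuo.
(* The component in the order continuous part is taken to be 0. *)
exists phi; split=> //; exists (fun=> 0), y, z; split=> // k.
- by rewrite add0r.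
- by have [y0 z0] := yz0 k.
- exact: order_continuous_part0.
Qed.
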